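(* Let $G$ be a random probability measure on the unit ball of a separable Hilbert space $H$ that satisfies the Ghirlanda-Guerra identities: for any $m\ge 2$, any bounded measurable function $f$ of the overlaps $(R_{l,l'})_{l,l'\le m}$ and any bounded measurable function $\psi:\mathbb{R}\to\mathbb{R}$, $$\mathbb{E}\bigl\langle f\,\psi(R_{1,m+1})\bigr\rangle=\frac1m\,\mathbb{E}\langle f\rangle\,\mathbb{E}\langle\psi(R_{1,2})\rangle+\frac1m\sum_{l=2}^m\mathbb{E}\bigl\langle f\,\psi(R_{1,l})\bigr\rangle .$$ Let $n\ge1$, let $f_1,\ldots,f_n:\mathbb{R}\to\mathbb{R}$ be bounded measurable functions, define $$F(\sigma,\sigma^1,\ldots,\sigma^n)=f_1(\sigma\cdot\sigma^1)+\cdots+f_n(\sigma\cdot\sigma^n),$$ and for $1\le l\le n$ define $$F_l(\sigma,\sigma^1,\ldots,\sigma^n)=F(\sigma,\sigma^1,\ldots,\sigma^n)-f_l(\sigma\cdot\sigma^l)+\mathbb{E}\langle f_l(R_{1,2})\rangle .$$ Let $\Phi$ be a bounded measurable function of $R^n=(R_{l,l'})_{l,l'\le n}$ (when $n=1$, $\Phi$ is understood to be a constant). Then $$\mathbb{E}\langle\Phi\rangle=\mathbb{E}\Bigl\langle\frac{\Phi\,\exp\sum_{l=1}^nF_l(\sigma^l,\sigma^1,\ldots,\sigma^n)}{\bigl(\langle\exp F(\sigma,\sigma^1,\ldots,\sigma^n)\rangle_{-}\bigr)^n}\Bigr\rangle ,$$ where $\langle\cdot\rangle_{-}$ in the denominator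 denotes the average with respect to $G$ in the variable $\sigma$ only, for fixed $\sigma^1,\ldots,\sigma^n$, and the outside average of the ratio is in $\sigma^1,\ldots,\sigma^n$.
   Context: Here $(\sigma^l)_{l\ge1}$ is an i.i.d. sample from $G$ (given $G$), $\langle\cdot\rangle$ denotes the average with respect to $G^{\otimes\infty}$, $\mathbb{E}$ denotes the expectation with respect to the randomness of $G$, and $R_{l,l'}=\sigma^l\cdot\sigma^{l'}$ is the scalar product (overlap) of $\sigma^l$ and $\sigma^{l'}$ in $H$ (including the diagonal $l=l'$). *)

(* Defs.v *)
From HB Require Import structures.
From mathcomp Require Import all_boot all_order all_algebra.
From mathcomp Require Import all_classical all_reals all_analysis.

Set Implicit Arguments.
Unset Strict Implicit.
Unset Printing Implicit Defensive.

Import Order.TTheory GRing.Theory Num.Theory.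
Import numFieldNormedType.Exports.

Local Open Scope classical_set_scope.
Local Open Scope ring_scope.

Definition borel (T : ptopologicalType) := g_sigma_algebraType (@open T).

Definition separable (T : topologicalType) :=
  exists2 D : set T, countable D & dense D.

(* A real Hilbert space is a complete normed module whose norm comes from
   [dot]. *)
Definition induces_norm (R : realType) (H : normedModType R)
  (dot : {dot H for idfun}) := forall x : H, dot x x = `|x| ^+ 2.

Section iid_product.
Context d (T : measurableType d) (R : realType).

Definition tcons n (p : T * n.-tuple T) : n.+1.-tuple T := cons_tuple p.1 p.2.

Fact measurable_tcons n : measurable_fun setT (@tcons n).
Proof. exact: measurable_cons. Qed.

HB.instance Definition _ n := isMeasurableFun.Build _ _ _ _ (@tcons n)
  (@measurable_tcons n).

(* The n-fold product measure, on tuples with the product sigma-algebra. *)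
Fixpoint iid_product (mu : probability T R) (n : nat) :
    probability (n.-tuple T) R :=
  match n with
  | 0%N => dirac [tuple]
  | n'.+1 => distribution (mu \x iid_product mu n')%E (@tcons n')
  end.

End iid_product.

Section replicas.
Context d (Omega : measurableType d) (R : realType).
Variable (H : completeNormedModType R).
Implicit Types (P : probability Omega R).

(* The measurable maps into [pprobability (borel H) R] are the maps [G] such
   that [w |-> G w A] is measurable for every Borel set [A]. *)
Definition random_probability := {mfun Omega >-> pprobability (borel H) R}.

Definition gibbs (G : random_probability) (w : Omega) :
  probability (borel H) R := G w.

(* [E< h >] for a function [h] of the randomness and of N replicas.  A function
   of finitely many replicas has the same average under the infinite product
   of [G w] as under the finite one. *)
Definition Eavg P (G : random_probability) (N : nat)
    (h : Omega -> N.-tuple H -> R) : R :=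
  \int[P]_w \int[iid_product (gibbs G w) N]_s h w s.

Variable dot : {dot H for idfun}.

(* Replicas are numbered from 0. *)
Definition overlap (s : seq H) (i j : nat) : R := dot s`_i s`_j.

(* The array of overlaps of the first m replicas, diagonal included, in a type
   carrying the product (i.e. Borel) sigma-algebra. *)
Definition overlaps (m : nat) (s : seq H) : m.-tuple (m.-tuple R) :=
  [tuple [tuple overlap s i j | j < m] | i < m].

Definition ghirlanda_guerra P (G : random_probability) : Prop :=
  forall (m : nat) (f : m.-tuple (m.-tuple R) -> R) (psi : R -> R),
    (2 <= m)%N ->
    measurable_fun setT f -> bounded_fun f ->
    measurable_fun setT psi -> bounded_fun psi ->
    Eavg P G (fun _ (s : m.+1.-tuple H) =>
        f (overlaps m s) * psi (overlap s 0 m)) =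
      m%:R^-1 * Eavg P G (fun _ (s : m.-tuple H) => f (overlaps m s))
              * Eavg P G (fun _ (s : 2.-tuple H) => psi (overlap s 0 1))
      + m%:R^-1 * \sum_(1 <= l < m)
          Eavg P G (fun _ (s : m.-tuple H) =>
            f (overlaps m s) * psi (overlap s 0 l)).

Definition F (n : nat) (f : 'I_n -> R -> R) (x : H) (s : seq H) : R :=
  \sum_(l < n) f l (dot x s`_l).

Definition Fl P (G : random_probability) (n : nat) (f : 'I_n -> R -> R)
    (l : 'I_n) (x : H) (s : seq H) : R :=
  F f x s - f l (dot x s`_l)
  + Eavg P G (fun _ (s' : 2.-tuple H) => f l (overlap s' 0 1)).

End replicas.

(* Main.v *)
Require Import Defs.
From HB Require Import structures.
From mathcomp Require Import all_boot all_order all_algebra.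
From mathcomp Require Import all_classical all_reals all_analysis.
From mathcomp Require Import fingroup perm measurable_realfun ring lra.

Set Implicit Arguments.
Unset Strict Implicit.
Unset Printing Implicit Defensive.

Import Order.TTheory GRing.Theory Num.Theory.
Import numFieldNormedType.Exports.

Local Open Scope classical_set_scope.
Local Open Scope ring_scope.

(* Put Z_t = <exp t F>_-, V = <F>_-, and let D_N be the sum of the F_l over the
   replicas l <= N, where F_l = F for l > n.  Writing Z_t^k as an average over k
   additional replicas gives
     E<Phi e^(t D_n) Z_t^k> = E<Phi e^(t D_(n+k))>.
   The Ghirlanda-Guerra identities, transported to every replica by
   exchangeability and summed, say that E<h D_N> = N E<h F(sigma^(N+1), .)> for
   every bounded function h of R^N.  Hence the t-derivative of
   E<Phi e^(t D_n) Z_t^k> is (n + k) E<Phi e^(t D_n) Z_t^k V>, and by linearity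
   that of E<Phi e^(t D_n) p(Z_t)> is E<Phi e^(t D_n) V (n p + X p')(Z_t)> for
   every polynomial p.  Since n p + X p' = 0 for p = X^-n, approximating X^-n in
   the C^1 sense by polynomials on an interval containing all values of Z_t
   shows that E<Phi e^(t D_n) / Z_t^n> is the same at t = 0 and t = 1.  The
   derivative is only used through increments, with a quadratic error. *)

(** * Bounded measurable functions and their integrals *)

Section bounded_measurable.
Context {R : realType}.

(** Such functions are integrable for every probability measure, so all integrability conditions
    below reduce to closure properties of this class. The bound is a plain existential so that it
    can be computed with directly. *)
Definition bmf d (T : measurableType d) (h : T -> R) :=
  measurable_fun setT h /\ exists M, forall x, `|h x| <= M.

Section closure.
Context {d} {T : measurableType d}.
Implicit Types h g : T -> R.

Lemma bmf_cst (c : R) : bmf (fun _ : T => c).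
Proof. by split; [exact: measurable_cst|exists `|c|]. Qed.

Lemma bmfD h g : bmf h -> bmf g -> bmf (fun x => h x + g x).
Proof.
move=> [mh [M hM]] [mg [N gN]]; split; first exact: measurable_funD.
by exists (M + N) => x; rewrite (le_trans (ler_normD _ _))// lerD.
Qed.

Lemma bmfM h g : bmf h -> bmf g -> bmf (fun x => h x * g x).
Proof.
move=> [mh [M hM]] [mg [N gN]]; split; first exact: measurable_funM.
by exists (M * N) => x; rewrite normrM ler_pM.
Qed.

Lemma bmfN h : bmf h -> bmf (fun x => - h x).
Proof.
move=> [mh [M hM]]; split; first exact: measurableT_comp.
by exists M => x; rewrite normrN.
Qed.

Lemma bmfB h g : bmf h -> bmf g -> bmf (fun x => h x - g x).
Proof. by move=> ? ?; apply: bmfD => //; exact: bmfN. Qed.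

Lemma bmfX h k : bmf h -> bmf (fun x => h x ^+ k).
Proof.
move=> bh; elim: k => [|k ih]; first exact: (bmf_cst 1).
by rewrite (eq_fun (fun x => exprS (h x) k)); exact: bmfM.
Qed.

Lemma bmf_sum I (r : seq I) (p : pred I) (h : I -> T -> R) :
  (forall i, p i -> bmf (h i)) -> bmf (fun x => \sum_(i <- r | p i) h i x).
Proof.
move=> bh; elim: r => [|i r ih].
  by rewrite (eq_fun (fun x => big_nil _ _ _ _)); exact: bmf_cst.
rewrite (eq_fun (fun x => big_cons _ _ _ _ _ _)).
by have := bh i; case: (p i) => // bhi; apply: bmfD => //; exact: bhi.
Qed.

Lemma bmf_expR h : bmf h -> bmf (fun x => expR (h x)).
Proof.
move=> [mh [M hM]]; split; first exact: measurableT_comp.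
exists (expR M) => x; rewrite ger0_norm ?expR_ge0// ler_expR.
exact: le_trans (ler_norm _) (hM x).
Qed.

End closure.

Lemma bmf_comp d d' (T : measurableType d) (U : measurableType d')
    (h : U -> R) (g : T -> U) :
  measurable_fun setT g -> bmf h -> bmf (fun x => h (g x)).
Proof.
by move=> mg [mh [M hM]]; split; [exact: measurableT_comp|exists M => x].
Qed.

Section integral.
Context {d} {T : measurableType d} (mu : probability T R).
Implicit Types h g : T -> R.

Lemma bmf_integrable h : bmf h -> mu.-integrable setT (EFin \o h).
Proof.
move=> [mh [M hM]]; apply: (@le_integrable _ _ _ _ _ _ _ (EFin \o cst M)) => //.
- exact/measurable_EFinP.
- by move=> x _ /=; rewrite lee_fin (le_trans (hM x)) ?ler_norm.
- exact: finite_measure_integrable_cst.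
Qed.

Lemma fine_prob1 : fine (mu setT) = 1.
Proof. by rewrite probability_setT. Qed.

Lemma ler_normr_Rintegral h M : bmf h -> (forall x, `|h x| <= M) ->
  `|\int[mu]_x h x| <= M.
Proof.
move=> bh hM; rewrite (le_trans (le_normr_Rintegral _ (bmf_integrable bh)))//.
rewrite -[leRHS]mulr1 -fine_prob1 -Rintegral_cst//; apply: le_Rintegral => //.
- exact/integrable_norm/bmf_integrable.
- exact/bmf_integrable/bmf_cst.
Qed.

End integral.

Lemma bmf_Rintegral_pprobability d d' (X : measurableType d)
    (Y : measurableType d') (mu : X -> pprobability Y R) (h : X * Y -> R) :
    measurable_fun setT mu -> bmf h ->
  bmf (fun x => \int[(mu x : probability Y R)]_y h (x, y)).
Proof.
move=> mmu bh; have [mh [M hM]] := bh.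
have bhx x : bmf (fun y => h (x, y)) by apply: (bmf_comp (g := pair x)).
split; last by exists M => x; exact: ler_normr_Rintegral.
have M0 x : 0 <= h x + M.
  by have := hM x; rewrite ler_norml => /andP[]; rewrite -subr_ge0 opprK.
(* Measurability of kernel integrals holds for nonnegative integrands, so [h] is shifted up by its
   bound [M], and [M] is subtracted after integration. *)
rewrite (_ : (fun _ => _) = fun x =>
    fine (\int[(mu x : probability Y R)]_y (h (x, y) + M)%:E)%E - M); last first.
  apply/funext => x; rewrite [X in X - M]RintegralD//.
  - by rewrite Rintegral_cst// fine_prob1 mulr1 addrK.
  - exact: bmf_integrable.
  - exact/bmf_integrable/bmf_cst.
apply: measurable_funB => //; apply: measurableT_comp => //.
apply: (measurable_fun_integral_finite_kernel (fun z => (h z + M)%:E)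
  (kprobability mmu)) => [z|]; first by rewrite lee_fin.
by apply/measurable_EFinP; exact: measurable_funD.
Qed.

End bounded_measurable.

(** * Product measures: Fubini, uniqueness, exchangeability, measurable dependence *)

Section iid_theory.
Context d (T : measurableType d) (R : realType) (mu : probability T R).

Lemma Rintegral_distribution d1 d2 (X : measurableType d1)
    (Y : measurableType d2) (P : probability X R) (phi : {mfun X >-> Y})
    (h : Y -> R) : bmf h ->
  \int[distribution P phi]_y h y = \int[P]_x h (phi x).
Proof.
move=> bh; congr fine.
have mphi : measurable_fun setT phi by [].
rewrite [LHS](integral_pushforward mphi)//.
- by apply/measurable_EFinP; case: bh.
- rewrite preimage_setT; apply: (@bmf_integrable _ _ _ P (h \o phi)).
  exact: bmf_comp.
Qed.

Lemma RFubini d1 d2 (X : measurableType d1) (Y : measurableType d2)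
    (m1 : probability X R) (m2 : probability Y R) (h : X * Y -> R) : bmf h ->
  \int[(m1 \x m2)%E]_z h z = \int[m1]_x \int[m2]_y h (x, y).
Proof.
move=> bh; rewrite /Rintegral -integral12_prod_meas1; last first.
  exact: bmf_integrable.
congr fine; apply: eq_integral => x _; rewrite fineK//.
apply: integrable_fin_num => //.
by apply: (@bmf_integrable _ _ _ m2 (fun y => h (x, y))); exact: bmf_comp.
Qed.

Lemma Rintegral_iid0 (h : 0.-tuple T -> R) :
  bmf h -> \int[iid_product mu 0]_s h s = h [tuple].
Proof.
move=> bh; rewrite /Rintegral integral_dirac//; last first.
  by apply/measurable_EFinP; case: bh.
by rewrite diracT mul1e.
Qed.

Lemma Rintegral_iidS n (h : n.+1.-tuple T -> R) : bmf h ->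
  \int[iid_product mu n.+1]_s h s =
  \int[mu]_x \int[iid_product mu n]_s h (tcons (x, s)).
Proof.
move=> bh; rewrite /= Rintegral_distribution// RFubini//.
by apply: bmf_comp => //; exact: measurable_tcons.
Qed.

Definition tuple_rect n (A : 'I_n -> set T) : set (n.-tuple T) :=
  [set s | forall i, A i (tnth s i)].

Lemma measurable_tuple_rect n (A : 'I_n -> set T) :
  (forall i, measurable (A i)) -> measurable (tuple_rect A).
Proof.
move=> mA; rewrite (_ : tuple_rect A = \bigcap_i (@tnth n T ^~ i) @^-1` A i).
  apply: fin_bigcap_measurable => // i _; rewrite -[_ @^-1` _]setTI.
  exact: measurable_tnth.
by apply/seteqP; split => s /= sA i; [move=> _; exact: sA|exact: sA].
Qed.

Lemma iid_tuple_rect n (A : 'I_n -> set T) : (forall i, measurable (A i)) ->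
  (iid_product mu n (tuple_rect A) = \prod_(i < n) mu (A i))%E.
Proof.
elim: n A => [|n ih] A mA.
  by rewrite big_ord0 /= diracE mem_set// => -[].
rewrite big_ord_recl -ih//= /distribution /pushforward -product_measure1E//.
  congr (product_measure1 _ _ _); apply/seteqP; split => -[x s] /=.
    move=> xsA; split=> [|i]; first exact: (xsA ord0).
    by have := xsA (lift ord0 i); rewrite tnthS.
  move=> [xA sA] i; case: (unliftP ord0 i) => [j ->|->]; last exact: xA.
  by rewrite tnthS; exact: sA.
exact: measurable_tuple_rect.
Qed.

Lemma measurable_tuple_rectE n : @measurable _ (n.-tuple T) =
  <<s [set tuple_rect A | A in [set A | forall i : 'I_n, measurable (A i)]] >>.
Proof.
apply/seteqP; split.
  apply: smallest_sub; first exact: smallest_sigma_algebra.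
  rewrite -bigcup_seq => B [i _ [A mA <-]]; apply: sub_sigma_algebra.
  (* A cylinder over coordinate [i] is the rectangle whose other sides are the whole space. *)
  exists (fun j => if j == i then A else setT).
    by move=> j /=; case: ifP.
  rewrite setTI; apply/seteqP; split => s /=.
    by move=> /(_ i); rewrite eqxx.
  by move=> sA j /=; case: eqP => // ->.
apply: smallest_sub; first exact: sigma_algebra_measurable.
by move=> _ [A mA <-]; exact: measurable_tuple_rect.
Qed.

(** Rectangles are stable under intersection, generate the sigma-algebra of tuples and include the
    whole space, so the masses of rectangles determine a probability. *)
Lemma iid_unique n (nu : probability (n.-tuple T) R) :
    (forall A, (forall i, measurable (A i)) ->
      nu (tuple_rect A) = \prod_(i < n) mu (A i))%E ->
  forall B, measurable B -> iid_product mu n B = nu B.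
Proof.
move=> nuE; apply: (measure_unique _ (fun=> setT) (measurable_tuple_rectE n)).
- move=> _ _ [A mA <-] [B mB <-]; exists (fun i => A i `&` B i) => [i|].
    exact: measurableI.
  apply/seteqP; split => s /= sAB.
    by split => i; have [] := sAB i.
  by move=> i; split; [exact: sAB.1|exact: sAB.2].
- by move=> _; exists (fun=> setT) => //; apply/seteqP; split.
- by rewrite bigcup_const.
- move=> _ [A mA <-]; exact: (etrans (iid_tuple_rect mA) (esym (nuE _ mA))).
- move=> _; apply: le_lt_trans (ltry 1).
  exact: (probability_le1 (iid_product mu n) measurableT).
Qed.

Definition tperm_tuple n (u : 'S_n) (s : n.-tuple T) : n.-tuple T :=
  [tuple tnth s (u i) | i < n].

Lemma measurable_tperm_tuple n (u : 'S_n) :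
  measurable_fun setT (tperm_tuple u).
Proof.
apply/measurable_fun_tnthP => i.
rewrite (_ : _ \o _ = @tnth n T ^~ (u i)); first exact: measurable_tnth.
by apply/funext => s /=; rewrite tnth_mktuple.
Qed.

HB.instance Definition _ n (u : 'S_n) := isMeasurableFun.Build _ _ _ _
  (@tperm_tuple n u) (measurable_tperm_tuple u).

(** Exchangeability: the image of the product measure under [u] gives a rectangle the same product
    of masses with its factors reordered, so [iid_unique] applies. *)
Lemma Rintegral_iid_perm n (u : 'S_n) (h : n.-tuple T -> R) : bmf h ->
  \int[iid_product mu n]_s h (tperm_tuple u s) = \int[iid_product mu n]_s h s.
Proof.
move=> bh; rewrite -(Rintegral_distribution (iid_product mu n) (tperm_tuple u))//.
congr fine; apply: eq_measure_integral => B mB _; apply/esym/iid_unique => // A mA.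
transitivity (iid_product mu n (tuple_rect (fun i => A ((u^-1)%g i)))).
  congr (iid_product mu n _); apply/seteqP; split => s /= sA i.
    by have := sA ((u^-1)%g i); rewrite tnth_mktuple permKV.
  by have := sA (u i); rewrite tnth_mktuple permK.
by rewrite iid_tuple_rect// [RHS](reindex_inj (@perm_inj _ (u^-1)%g)).
Qed.

Lemma measurable_rcons n :
  measurable_fun setT (fun p : n.-tuple T * T => [tuple of rcons p.1 p.2]).
Proof.
apply/measurable_fun_tnthP => i; have [ni|ni] := ltnP i n.
  rewrite (_ : _ \o _ = (fun s => tnth s (Ordinal ni)) \o fst).
    by apply: measurableT_comp => //; exact: measurable_tnth.
  apply/funext => -[s x] /=.
  by rewrite !(tnth_nth x) /= nth_rcons size_tuple ni.
rewrite (_ : _ \o _ = snd)//; apply/funext => -[s x] /=.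
rewrite (tnth_nth x) /= nth_rcons size_tuple ltnNge ni /= eqn_leq ni andbT.
by rewrite -ltnS ltn_ord.
Qed.

End iid_theory.

(** [iid_product] splits off the first coordinate, whereas a new replica is to be appended at the
    end so that the earlier ones keep their numbers. *)
Lemma Rintegral_iid_rcons d (T : measurableType d) (R : realType)
    (mu : probability T R) n (h : n.+1.-tuple T -> R) : bmf h ->
  \int[iid_product mu n.+1]_s h s =
  \int[iid_product mu n]_s \int[mu]_x h [tuple of rcons s x].
Proof.
elim: n h => [|n ih] h bh.
  rewrite Rintegral_iidS// Rintegral_iid0; last first.
    have bh0 : bmf (fun p : 0.-tuple T * T => h [tuple of rcons p.1 p.2]).
      by apply: bmf_comp => //; exact: measurable_rcons.
    exact: (bmf_Rintegral_pprobability (mu := fun=> mu) (measurable_cst _) bh0).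
  apply: eq_Rintegral => x _; rewrite Rintegral_iid0; last first.
    apply: (bmf_comp (g := fun s => tcons (x, s))) bh;
    apply: (measurableT_comp (@measurable_tcons _ _ _)).
    exact: pair1_measurable.
  by congr h; apply: val_inj.
have btcons x : bmf (fun s => h (tcons (x, s))).
  apply: (bmf_comp (g := fun s => tcons (x, s))) bh;
    apply: (measurableT_comp (@measurable_tcons _ _ _)).
  exact: pair1_measurable.
rewrite Rintegral_iidS//; under eq_Rintegral do rewrite ih//.
rewrite Rintegral_iidS; last first.
  have bh0 : bmf (fun p : n.+1.-tuple T * T => h [tuple of rcons p.1 p.2]).
    by apply: bmf_comp => //; exact: measurable_rcons.
  exact: (bmf_Rintegral_pprobability (mu := fun=> mu) (measurable_cst _) bh0).
apply: eq_Rintegral => x _; apply: eq_Rintegral => s _.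
by apply: eq_Rintegral => y _; congr h; apply: val_inj.
Qed.

Lemma bmf_Rintegral_iid d (T : measurableType d) (R : realType) n :
  forall d' (X : measurableType d') (mu : X -> pprobability T R)
    (h : X * n.-tuple T -> R), measurable_fun setT mu -> bmf h ->
  bmf (fun x => \int[iid_product (mu x : probability T R) n]_s h (x, s)).
Proof.
elim: n => [|n ih] d' X mu h mmu bh.
  rewrite (_ : (fun _ => _) = fun x => h (x, [tuple])).
    by apply: bmf_comp => //; exact: measurable_pair2.
  by apply/funext => x; rewrite Rintegral_iid0//; apply: bmf_comp bh.
have mc : measurable_fun setT
    (fun p : (X * T) * n.-tuple T => (p.1.1, tcons (p.1.2, p.2))).
  apply/measurable_fun_pairP; split.
    exact: (measurableT_comp measurable_fst measurable_fst).
  apply: (measurableT_comp (@measurable_tcons _ _ n)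
    (_ : measurable_fun setT (fun p : (X * T) * n.-tuple T => (p.1.2, p.2)))).
  apply/measurable_fun_pairP; split; last exact: measurable_snd.
  exact: (measurableT_comp measurable_snd measurable_fst).
have := ih _ _ (mu \o fst) _ (measurableT_comp mmu measurable_fst)
  (bmf_comp mc bh) => /(bmf_Rintegral_pprobability mmu).
congr bmf; apply/funext => x /=.
by rewrite Rintegral_iidS//; apply: bmf_comp bh.
Qed.

(** * Linearity and exchangeability of the average over replicas and randomness *)

Section Eavg_theory.
Context d (Omega : measurableType d) (R : realType).
Context (H : completeNormedModType R) (P : probability Omega R).
Variable G : random_probability Omega H.

(** Joint measurability is what makes the inner average a measurable function of the randomness. *)
Definition bmf2 N (h : Omega -> N.-tuple (borel H) -> R) :=
  bmf (fun p : Omega * N.-tuple (borel H) => h p.1 p.2).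

Let E N (h : Omega -> N.-tuple (borel H) -> R) := Eavg P G h.

Lemma measurable_gibbs :
  measurable_fun setT (G : Omega -> pprobability (borel H) R).
Proof. by []. Qed.

Lemma bmf2_slice N (h : Omega -> N.-tuple (borel H) -> R) w :
  bmf2 h -> bmf (h w).
Proof. by move=> bh; exact: (bmf_comp (g := pair w) _ bh). Qed.

Lemma bmf_Eavg_inner N (h : Omega -> N.-tuple (borel H) -> R) : bmf2 h ->
  bmf (fun w => \int[iid_product (gibbs G w) N]_s h w s).
Proof. by move=> bh; exact: (bmf_Rintegral_iid measurable_gibbs bh). Qed.

Lemma EavgD N (h g : Omega -> N.-tuple (borel H) -> R) : bmf2 h -> bmf2 g ->
  E (fun w s => h w s + g w s) = E h + E g.
Proof.
move=> bh bg; rewrite /E /Eavg -RintegralD//.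
- apply: eq_Rintegral => w _; rewrite RintegralD//.
  + exact/bmf_integrable/bmf2_slice.
  + exact/bmf_integrable/bmf2_slice.
- exact/bmf_integrable/bmf_Eavg_inner.
- exact/bmf_integrable/bmf_Eavg_inner.
Qed.

Lemma EavgZ N c (h : Omega -> N.-tuple (borel H) -> R) : bmf2 h ->
  E (fun w s => c * h w s) = c * E h.
Proof.
move=> bh; rewrite /E /Eavg -RintegralZl//.
  apply: eq_Rintegral => w _; rewrite RintegralZl//.
  exact/bmf_integrable/bmf2_slice.
exact/bmf_integrable/bmf_Eavg_inner.
Qed.

Lemma EavgB N (h g : Omega -> N.-tuple (borel H) -> R) : bmf2 h -> bmf2 g ->
  E (fun w s => h w s - g w s) = E h - E g.
Proof.
move=> bh bg; rewrite /E /Eavg -RintegralB//.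
- apply: eq_Rintegral => w _; rewrite RintegralB//.
  + exact/bmf_integrable/bmf2_slice.
  + exact/bmf_integrable/bmf2_slice.
- exact/bmf_integrable/bmf_Eavg_inner.
- exact/bmf_integrable/bmf_Eavg_inner.
Qed.

Lemma Eavg_cst N c : E (fun _ (_ : N.-tuple (borel H)) => c) = c.
Proof.
rewrite /E /Eavg; under eq_Rintegral do rewrite Rintegral_cst// fine_prob1 mulr1.
by rewrite Rintegral_cst// fine_prob1 mulr1.
Qed.

Lemma Eavg_sum N I (r : seq I) (p : pred I)
    (h : I -> Omega -> N.-tuple (borel H) -> R) : (forall i, p i -> bmf2 (h i)) ->
  E (fun w s => \sum_(i <- r | p i) h i w s) = \sum_(i <- r | p i) E (h i).
Proof.
move=> bh; elim: r => [|i r ih].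
  rewrite big_nil -[RHS](Eavg_cst N 0); congr (Eavg P G _).
  by apply/funext => w; apply/funext => s; rewrite big_nil.
transitivity (E (fun w s => (if p i then h i w s else 0) +
    \sum_(i <- r | p i) h i w s)).
  congr (Eavg P G _); apply/funext => w; apply/funext => s; rewrite big_cons.
  by case: ifP; rewrite ?add0r.
rewrite EavgD ?ih ?big_cons.
- case: ifP => // _.
  by rewrite (_ : E _ = 0) ?add0r//; exact: Eavg_cst.
- have := bh i; case: (p i) => [/(_ isT)//|_]; exact: bmf_cst.
- exact: bmf_sum.
Qed.

Lemma ler_norm_Eavg N (h : Omega -> N.-tuple (borel H) -> R) M : bmf2 h ->
  (forall w s, `|h w s| <= M) -> `|E h| <= M.
Proof.
move=> bh hM; apply: ler_normr_Rintegral => [|w]; first exact: bmf_Eavg_inner.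
by apply: ler_normr_Rintegral => //; exact: bmf2_slice.
Qed.

Lemma Eavg_perm N (u : {perm 'I_N}) (h : Omega -> N.-tuple (borel H) -> R) :
  bmf2 h -> E (fun w s => h w (tperm_tuple u s)) = E h.
Proof.
move=> bh; apply: eq_Rintegral => w _.
by rewrite Rintegral_iid_perm//; exact: bmf2_slice.
Qed.

Lemma Eavg_rcons N (h : Omega -> N.+1.-tuple (borel H) -> R) : bmf2 h ->
  E h = E (fun w s => \int[gibbs G w]_x h w [tuple of rcons s x]).
Proof.
move=> bh; apply: eq_Rintegral => w _.
by rewrite Rintegral_iid_rcons//; exact: bmf2_slice.
Qed.

Lemma bmf2_Rintegral_gibbs N
    (h : (Omega * N.-tuple (borel H)) * borel H -> R) : bmf h ->
  bmf2 (fun w s => \int[gibbs G w]_x h ((w, s), x)).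
Proof.
move=> bh; have := bmf_Rintegral_pprobability
  (measurableT_comp measurable_gibbs (@measurable_fst _ _ _ (N.-tuple (borel H)))) bh.
by congr bmf; apply/funext => -[].
Qed.

End Eavg_theory.

(** * Measurability of the scalar product and of the overlaps *)

Section dot_theory.
Context (R : realType) (H : completeNormedModType R) (dot : {dot H for idfun}).

Lemma dotC x y : dot x y = dot y x.
Proof. by rewrite hermC/= expr0 mul1r. Qed.

(** Polarization reduces the measurability of [dot] to that of norms and distances. *)
Lemma dot_polar x y :
  dot x y = 2^-1 * (dot x x + dot y y - dot (x - y) (x - y)).
Proof.
by rewrite linearBl /= !linearBr /= (dotC y x); field.
Qed.

Hypothesis Hsep : separable H.

(** An injection of [D] into the naturals turns the union into a sequence of unions, each over at
    most one index. *)
Lemma countable_bigcup_measurable d (T : measurableType d) I (D : set I)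
    (F : I -> set T) : countable D -> (forall i, measurable (F i)) ->
  measurable (\bigcup_(i in D) F i).
Proof.
move=> /countable_injP[f injf] mF.
rewrite (_ : \bigcup_(i in D) F i =
    \bigcup_k \bigcup_(i in D `&` f @^-1` [set k]) F i).
  apply: bigcupT_measurable => k.
  have [->|/set0P[i [Di fi]]] := eqVneq (D `&` f @^-1` [set k]) set0.
    by rewrite bigcup_set0.
  rewrite (_ : _ `&` _ = [set i]) ?bigcup_set1//.
  apply/seteqP; split => [j [Dj fj]|_ ->//].
  by move: fi fj => <- fj; apply: injf => //; exact/mem_set.
apply/seteqP; split => [x [i Di Fx]|x [k _ [i [Di _] Fx]]]; last by exists i.
by exists (f i) => //; exists i.
Qed.

Lemma measurable_borel_open (A : set H) :
  open A -> measurable (A : set (borel H)).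
Proof. exact: sub_sigma_algebra. Qed.

Lemma measurable_norm_sub (q : H) :
  measurable_fun setT (fun x : borel H => `|(x : H) - q|).
Proof.
apply: (measurability _ (RGenInftyO.measurableE R)) => _ /= [_ [r ->] <-].
rewrite setTI; apply: measurable_borel_open.
have cq : continuous (fun x : H => `|x - q|).
  by move=> x; apply: cvg_norm; apply: cvgB; [exact: cvg_id|exact: cvg_cst].
by apply: (@open_comp _ _ (fun x : H => `|x - q|)) => [x _|]; [exact: cq|].
Qed.

(** The pair carries the product sigma-algebra, so continuity alone does not suffice. Separability
    writes [|x - y| < r] as a countable union of conditions [|x - q| + |y - q| < r], each built from
    functions of one variable. *)
Lemma measurable_dist :
  measurable_fun setT (fun p : borel H * borel H => `|(p.1 : H) - p.2|).
Proof.
have [D cD dD] := Hsep.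
apply: (measurability _ (RGenInftyO.measurableE R)) => _ /= [_ [r ->] <-].
rewrite setTI (_ : _ @^-1` _ = \bigcup_(q in D)
    [set p : borel H * borel H | `|(p.1 : H) - q| + `|(p.2 : H) - q| < r]).
  apply: countable_bigcup_measurable => // q.
  have mq : measurable_fun setT (fun p : borel H * borel H =>
      `|(p.1 : H) - q| + `|(p.2 : H) - q|).
    apply: measurable_funD.
      exact: (measurableT_comp (measurable_norm_sub q) measurable_fst).
    exact: (measurableT_comp (measurable_norm_sub q) measurable_snd).
  have := mq measurableT `]-oo, r[%classic (measurable_itv _).
  by rewrite setTI; congr measurable; apply/seteqP; split => p /=; rewrite in_itv.
apply/seteqP; split => -[x y] /=; rewrite in_itv /=.
  (* Half of the slack, because [|x - q| + |y - q|] exceeds [|x - y|] by at most twice [|y - q|]. *)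
  move=> xyr; have e0 : 0 < (r - `|x - y|) / 2 by rewrite divr_gt0// subr_gt0.
  have [|q [xq Dq]] := dD (ball (y : H) ((r - `|x - y|) / 2)) _ (ball_open _ _).
    by exists y; exact: ballxx.
  exists q => //=; move: xq; rewrite -ball_normE /= => yq.
  have : `|x - q| <= `|x - y| + `|y - q|.
    exact: ler_distD.
  by lra.
move=> [q Dq] /=; apply: le_lt_trans.
by rewrite (distrC y); exact: ler_distD.
Qed.

Hypothesis Hdot : induces_norm dot.

Lemma measurable_dot :
  measurable_fun setT (fun p : borel H * borel H => dot p.1 p.2).
Proof.
have m0 : measurable_fun setT (fun x : borel H => dot x x).
  rewrite (_ : (fun _ => _) = fun x : borel H => `|(x : H) - 0| ^+ 2).
    by apply: measurable_funX; exact: measurable_norm_sub.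
  by apply/funext => x; rewrite Hdot subr0.
rewrite (eq_fun (fun p : borel H * borel H => dot_polar p.1 p.2)).
apply: measurable_funM => //; apply: measurable_funB; first apply: measurable_funD.
- exact: (measurableT_comp m0 measurable_fst).
- exact: (measurableT_comp m0 measurable_snd).
rewrite (eq_fun (fun p : borel H * borel H => Hdot (p.1 - p.2))).
by apply: measurable_funX; exact: measurable_dist.
Qed.

Lemma measurable_nth N i :
  measurable_fun setT (fun s : N.-tuple (borel H) => (s`_i : borel H)).
Proof.
have [iN|Ni] := ltnP i N.
  rewrite (_ : (fun _ => _) = (@tnth N (borel H) ^~ (Ordinal iN))).
    exact: measurable_tnth.
  by apply/funext => s; rewrite (tnth_nth 0).
rewrite (_ : (fun _ => _) = fun=> (0 : borel H)); first exact: measurable_cst.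
by apply/funext => s; rewrite nth_default// size_tuple.
Qed.

Lemma measurable_overlap N i j :
  measurable_fun setT (fun s : N.-tuple (borel H) => overlap dot s i j).
Proof.
apply: (measurableT_comp measurable_dot
  (_ : measurable_fun setT (fun s : N.-tuple (borel H) =>
    (s`_i : borel H, s`_j : borel H)))).
by apply/measurable_fun_pairP; split; exact: measurable_nth.
Qed.

Lemma measurable_overlaps m N :
  measurable_fun setT (fun s : N.-tuple (borel H) => overlaps dot m s).
Proof.
apply/measurable_fun_tnthP => i; apply/measurable_fun_tnthP => j.
rewrite (_ : _ \o _ = fun s : N.-tuple (borel H) => overlap dot s i j).
  exact: measurable_overlap.
by apply/funext => s /=; rewrite !tnth_mktuple.
Qed.

End dot_theory.

Lemma bounded_funP (T : Type) (R : realType) (h : T -> R) :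
  bounded_fun h <-> exists M, forall x, `|h x| <= M.
Proof.
split=> [[M [_ hM]]|[M hM]].
  by exists (M + 1) => x; apply: (hM (M + 1)) => //; rewrite ltrDl.
exists M; split=> [|N MN x _]; first exact: num_real.
exact: le_trans (hM x) (ltW MN).
Qed.

(** * The Ghirlanda-Guerra identities at every replica and in summed form *)

Section ghirlanda_guerra_theory.
Context (R : realType) (H : completeNormedModType R) (dot : {dot H for idfun}).
Hypotheses (Hdot : induces_norm dot) (Hsep : separable H).
Context (d : measure_display) (Omega : measurableType d).
Context (P : probability Omega R) (G : random_probability Omega H).

Let E N (h : Omega -> N.-tuple (borel H) -> R) := Eavg P G h.

Lemma bmf2_fst N (h : N.-tuple (borel H) -> R) :
  bmf h -> bmf2 (fun (_ : Omega) s => h s).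
Proof. by move=> bh; exact: (bmf_comp measurable_snd bh). Qed.

Lemma bmf_overlaps m N (h : m.-tuple (m.-tuple R) -> R) : bmf h ->
  bmf (fun s : N.-tuple (borel H) => h (overlaps dot m s)).
Proof. by move=> bh; apply: bmf_comp bh; exact: measurable_overlaps. Qed.

Lemma bmf_overlap N (h : R -> R) i j : bmf h ->
  bmf (fun s : N.-tuple (borel H) => h (overlap dot s i j)).
Proof. by move=> bh; apply: bmf_comp bh; exact: measurable_overlap. Qed.

Definition array_perm N (u : {perm 'I_N}) (r : N.-tuple (N.-tuple R)) :
    N.-tuple (N.-tuple R) :=
  [tuple [tuple tnth (tnth r (u i)) (u j) | j < N] | i < N].

Lemma measurable_array_perm N (u : {perm 'I_N}) :
  measurable_fun setT (array_perm u).
Proof.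
apply/measurable_fun_tnthP => i; apply/measurable_fun_tnthP => j.
rewrite (_ : _ \o _ = (@tnth N R ^~ (u j)) \o (@tnth N (N.-tuple R) ^~ (u i))).
  apply: measurableT_comp; exact: measurable_tnth.
by apply/funext => r /=; rewrite !tnth_mktuple.
Qed.

Lemma nth_tperm_tuple N (u : {perm 'I_N}) (s : N.-tuple (borel H)) (i : 'I_N) :
  (tperm_tuple u s : seq H)`_i = (s : seq H)`_(u i).
Proof.
have -> : (tperm_tuple u s : seq H)`_i = tnth (tperm_tuple u s) i.
  by rewrite (tnth_nth (0 : H)).
by rewrite tnth_mktuple (tnth_nth (0 : H)).
Qed.

(** Serves with [M = N], and with [M = N + 1], where [v] fixes the additional replica. *)
Lemma overlaps_perm N M (u : {perm 'I_N}) (v : {perm 'I_M}) (NM : (N <= M)%N)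
    (s : M.-tuple (borel H)) :
  (forall i, v (widen_ord NM i) = widen_ord NM (u i)) ->
  overlaps dot N (tperm_tuple v s) = array_perm u (overlaps dot N s).
Proof.
move=> vu; apply: eq_from_tnth => i; apply: eq_from_tnth => j.
rewrite !tnth_mktuple /overlap -[i : nat]/(widen_ord NM i : nat).
by rewrite -[j : nat]/(widen_ord NM j : nat) !nth_tperm_tuple !vu.
Qed.

Hypothesis GG : ghirlanda_guerra dot P G.

(** The identity at replica 0 is carried to replica [l] by the transposition of the two, under which
    the average is invariant. The case of one replica, not covered by [ghirlanda_guerra], is direct
    for constant [h]: both sides are the constant times the mean of [psi]. *)
Lemma ghirlanda_guerra_replica N (h : N.-tuple (N.-tuple R) -> R) (psi : R -> R)
    (l : 'I_N) : bmf h -> bmf psi ->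
    (N = 1%N -> exists c, forall r, h r = c) ->
  N%:R * E (fun _ (s : N.+1.-tuple (borel H)) =>
             h (overlaps dot N s) * psi (overlap dot s l N)) =
  E (fun _ (s : N.-tuple (borel H)) => h (overlaps dot N s)) *
    E (fun _ (s : 2.-tuple (borel H)) => psi (overlap dot s 0 1)) +
  \sum_(j < N | j != l) E (fun _ (s : N.-tuple (borel H)) =>
    h (overlaps dot N s) * psi (overlap dot s l j)).
Proof.
move=> bh bpsi; have [N1|N1] := leqP N 1.
  have NE : N = 1%N by apply/eqP; rewrite eqn_leq N1 (leq_trans _ (ltn_ord l)).
  move=> /(_ NE)[c hc]; subst N; rewrite mul1r big_pred0 ?addr0; last first.
    by move=> j; rewrite !ord1.
  transitivity (E (fun _ (s : 2.-tuple (borel H)) =>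
      c * psi (overlap dot s 0 1))).
    congr (Eavg P G _); apply/funext => w; apply/funext => s.
    by rewrite hc ord1.
  rewrite /E EavgZ; last exact/bmf2_fst/bmf_overlap.
  congr (_ * _); rewrite -[LHS](Eavg_cst P G 1); congr (Eavg P G _).
  by apply/funext => w; apply/funext => s; rewrite hc.
move=> _; have N0 : (0 < N)%N by exact: ltnW.
pose o := Ordinal N0; pose u := tperm o l.
have NN : (N <= N.+1)%N by [].
(* [v] is [u] on the first [N] replicas and fixes the new one. *)
pose v := tperm (widen_ord NN o) (widen_ord NN l).
have wI : injective (widen_ord NN) by move=> i j /(congr1 val)/= /val_inj.
have vu i : v (widen_ord NN i) = widen_ord NN (u i).
  by rewrite /v /u !permE /= !(inj_eq wI); do 2 case: ifP => //.
have uu i : u (widen_ord (leqnn N) i) = widen_ord (leqnn N) (u i).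
  by rewrite (_ : widen_ord _ i = i); apply: val_inj.
have vN : v ord_max = ord_max.
  by rewrite tpermD// -val_eqE /= neq_ltn ?ltn_ord ?N0.
(* The hypothesis is applied to the permuted function; exchangeability then undoes the permutation
   in each of its averages. *)
have bh' : bmf (h \o array_perm u).
  by apply: bmf_comp bh; exact: measurable_array_perm.
have := GG N1 bh'.1 ((bounded_funP _).2 bh'.2) bpsi.1 ((bounded_funP _).2 bpsi.2).
have -> : Eavg P G (fun _ (s : N.+1.-tuple H) =>
    (h \o array_perm u) (overlaps dot N s) * psi (overlap dot s 0 N)) =
    E (fun _ (s : N.+1.-tuple (borel H)) =>
      h (overlaps dot N s) * psi (overlap dot s l N)).
  rewrite /E -[RHS](Eavg_perm P G v); last first.
    by apply/bmf2_fst/bmfM; [exact: bmf_overlaps|exact: bmf_overlap].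
  congr (Eavg P G _); apply/funext => w; apply/funext => s.
  rewrite (overlaps_perm s vu); congr (_ * psi _); rewrite /overlap.
  rewrite -[nat_of_ord l]/(widen_ord NN l : nat) nth_tperm_tuple.
  have := nth_tperm_tuple v s ord_max; rewrite vN /= => ->.
  by rewrite tpermR.
have -> : Eavg P G (fun _ (s : N.-tuple H) =>
    (h \o array_perm u) (overlaps dot N s)) =
    E (fun _ (s : N.-tuple (borel H)) => h (overlaps dot N s)).
  rewrite /E -[RHS](Eavg_perm P G u); last exact/bmf2_fst/bmf_overlaps.
  congr (Eavg P G _); apply/funext => w; apply/funext => s.
  by rewrite (overlaps_perm s uu).
pose S i := E (fun _ (s : N.-tuple (borel H)) =>
  h (overlaps dot N s) * psi (overlap dot s l i)).
have -> : \sum_(1 <= i < N) Eavg P G (fun _ (s : N.-tuple H) =>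
      (h \o array_perm u) (overlaps dot N s) * psi (overlap dot s 0 i)) =
    \sum_(i < N | i != l) S i.
  (* The sum over replicas other than 0 becomes, reindexed by [u], the sum over replicas other than
     [l]. *)
  pose S' i := E (fun _ (s : N.-tuple (borel H)) =>
    (h \o array_perm u) (overlaps dot N s) * psi (overlap dot s 0 i)).
  rewrite -[LHS]/(\sum_(1 <= i < N) S' i).
  have -> : \sum_(1 <= i < N) S' i = \sum_(i < N | i != o) S' i.
    apply: (addrI (S' 0%N)); rewrite -(big_ltn (F := S'))// big_mkord.
    by rewrite (bigD1 o).
  rewrite [RHS](reindex_inj (@perm_inj _ u)) /=.
  apply: eq_big => [i|i _].
    by rewrite -[l in RHS](tpermL o l) (inj_eq (@perm_inj _ u)).
  rewrite /S /S' /E -[RHS](Eavg_perm P G u); last first.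
    by apply/bmf2_fst/bmfM; [exact: bmf_overlaps|exact: bmf_overlap].
  congr (Eavg P G _); apply/funext => w; apply/funext => s.
  rewrite (overlaps_perm s uu) /overlap !nth_tperm_tuple.
  by rewrite /u tpermR tpermK.
move=> ->; rewrite mulrDr !mulrA mulfV ?mul1r//.
by rewrite pnatr_eq0 -lt0n.
Qed.

Context (n : nat) (f : 'I_n -> R -> R).
Hypothesis bf : forall l, bmf (f l).

Let e l := E (fun _ (s : 2.-tuple (borel H)) => f l (overlap dot s 0 1)).

(* The replicas [j < n] contribute [F_j] of the statement, the additional ones
   [n <= j < N] contribute [F] without correction. *)
Definition energy N (s : seq H) : R :=
  \sum_(j < N) F dot f s`_j s - \sum_(l < n) f l (overlap dot s l l)
  + \sum_(l < n) Eavg P G (fun _ (s' : 2.-tuple H) => f l (overlap dot s' 0 1)).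

(** Expand [F] at the new replica into its terms [f l] and apply the identity at replica [l] to
    each. The mean of [f l] together with the overlaps of [l] with all other replicas is exactly
    what [energy] collects. *)
Lemma ghirlanda_guerra_energy N (h : N.-tuple (N.-tuple R) -> R) :
    (n <= N)%N -> bmf h -> (N = 1%N -> exists c, forall r, h r = c) ->
  E (fun _ (s : N.-tuple (borel H)) => h (overlaps dot N s) * energy N s) =
  N%:R * E (fun _ (s : N.+1.-tuple (borel H)) =>
    h (overlaps dot N s) * F dot f (s : seq H)`_N s).
Proof.
move=> nN bh h1.
have bhs : bmf2 (fun (_ : Omega) (s : N.-tuple (borel H)) =>
    h (overlaps dot N s)) by exact/bmf2_fst/bmf_overlaps.
have bhf M l i j : bmf2 (fun (_ : Omega) (s : M.-tuple (borel H)) =>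
    h (overlaps dot N s) * f l (overlap dot s i j)).
  by apply/bmf2_fst/bmfM; [exact: bmf_overlaps|exact: bmf_overlap].
transitivity (\sum_(l < n) N%:R * E (fun _ (s : N.+1.-tuple (borel H)) =>
    h (overlaps dot N s) * f l (overlap dot s l N))); last first.
  rewrite -mulr_sumr; congr (_ * _).
  transitivity (E (fun _ (s : N.+1.-tuple (borel H)) => \sum_(l < n)
      h (overlaps dot N s) * f l (overlap dot s l N))).
    by rewrite /E Eavg_sum// => l _; exact: bhf.
  congr (Eavg P G _); apply/funext => w; apply/funext => s.
  rewrite mulr_sumr; apply: eq_bigr => l _.
  by rewrite /overlap dotC.
under [RHS]eq_bigr => l _.
  rewrite -[nat_of_ord l]/(widen_ord nN l : nat).
  rewrite (ghirlanda_guerra_replica _ bh (bf l) h1); over.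
transitivity (E (fun _ (s : N.-tuple (borel H)) => \sum_(l < n)
    (e l * h (overlaps dot N s) + \sum_(j < N | j != widen_ord nN l)
      h (overlaps dot N s) * f l (overlap dot s l j)))); last first.
  rewrite /E Eavg_sum => [|l _]; last first.
    apply: bmfD; first by apply: bmfM => //; exact: bmf_cst.
    by apply: bmf_sum => j _; exact: bhf.
  apply: eq_bigr => l _; rewrite EavgD.
  - by rewrite EavgZ// Eavg_sum// mulrC.
  - by apply: bmfM => //; exact: bmf_cst.
  - by apply: bmf_sum => j _; exact: bhf.
congr (Eavg P G _); apply/funext => w; apply/funext => s.
rewrite big_split /= -mulr_suml addrC mulrC /energy mulrDl; congr (_ + _).
(* With the sum over [l] outside, the subtracted self-overlap cancels the term [j = l]. *)
rewrite [X in X - _]exchange_big /= -sumrB mulr_suml; apply: eq_bigr => l _.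
rewrite (bigD1 (widen_ord nN l))//= addrAC subrr add0r mulr_suml.
by apply: eq_bigr => j _; rewrite mulrC /overlap dotC.
Qed.

End ghirlanda_guerra_theory.

(** * Polynomial approximation of inverse powers together with a differential equation *)

Section polynomial_approximation.
Context (R : realType).

(** With [r = t ^ 2], one factor [t ^ k] absorbs [k + 1]: it is the least term of a geometric sum of
    [k + 1] terms, which is at most [1 / (1 - t)]. The other factor tends to zero. *)
Lemma succn_expr_small (r e : R) : 0 <= r -> r < 1 -> 0 < e ->
  exists k, k.+1%:R * r ^+ k <= e.
Proof.
move=> r0 r1 e0; pose t := Num.sqrt r.
have t0 : 0 <= t by exact: sqrtr_ge0.
have t1 : t < 1 by rewrite -sqrtr1 ltr_sqrt.
have rt : r = t * t by rewrite -expr2 sqr_sqrtr.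
have te : 0 < e * (1 - t) by rewrite mulr_gt0// subr_gt0.
have : t ^+ k @[k --> \oo] --> (0 : R) by apply: cvg_expr; rewrite ger0_norm.
move=> /cvgr0Pnorm_le/(_ _ te)[k _ /(_ k (leqnn k))] /=.
rewrite ger0_norm ?exprn_ge0// => tk.
exists k; rewrite rt exprMn mulrA.
have kt : k.+1%:R * t ^+ k * (1 - t) <= 1.
  have -> : k.+1%:R * t ^+ k = \sum_(j < k.+1) t ^+ k.
    by rewrite sumr_const card_ord mulr_natl.
  have := subrX1 t k.+1; rewrite -opprB -[t - 1]opprB mulNr => /oppr_inj h.
  apply: (@le_trans _ _ (1 - t ^+ k.+1)); last by rewrite gerBl exprn_ge0.
  rewrite h mulrC ler_pM2l ?subr_gt0//; apply: ler_sum => j _.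
  by apply: ler_wiXn2l; [|exact: ltW|rewrite -ltnS].
rewrite -(ler_pM2r (_ : 0 < 1 - t)) ?subr_gt0//.
rewrite mulrAC (le_trans _ tk)// ler_piMl ?exprn_ge0//.
Qed.

(** Bernoulli's inequality, used to pass from the error of [z q(z)] to that of its powers. *)
Lemma subr1_expr_le (x : R) k : 0 <= x <= 1 -> 1 - (1 - x) ^+ k <= k%:R * x.
Proof.
move=> /andP[x0 x1]; elim: k => [|k ih]; first by rewrite expr0 subrr mul0r.
have y0 : 0 <= (1 - x) ^+ k by rewrite exprn_ge0// subr_ge0.
have y1 : (1 - x) ^+ k <= 1 by rewrite exprn_ile1 ?subr_ge0// gerBl.
rewrite exprS -natr1; nra.
Qed.

Variables (b : R).
Hypothesis b0 : 0 < b.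

Let g : {poly R} := 1 - b^-1 *: 'X.
Let q M : {poly R} := b^-1 *: \sum_(j < M) g ^+ j.

(* [q M] is the truncated expansion of [z^-1] at [b]: [z q(z)] differs from [1]
   by [(1 - z / b) ^+ M]. *)
Let XqE M : 'X * q M = 1 - g ^+ M.
Proof.
have -> : 'X * q M = (1 - g) * \sum_(j < M) g ^+ j.
  by rewrite /q -scalerAr scalerAl /g opprB addrCA subrr addr0.
by rewrite -opprB mulNr -subrX1 opprB.
Qed.

Let gE z : g.[z] = 1 - z / b.
Proof. by rewrite /g !hornerE mulrC. Qed.

Let qE z M : z * (q M).[z] = 1 - (1 - z / b) ^+ M.
Proof.
have /(congr1 (fun p : {poly R} => p.[z])) := XqE M.
by rewrite hornerM hornerX hornerD hornerN horner_exp gE hornerC.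
Qed.

(** The derivative of [z q(z)]. For [p = q ^ n] one has [n p + z p' = n q ^ (n - 1) (q + z q')], so
    this is the factor that has to be small. *)
Let dqE z k : (q k.+1).[z] + z * (q k.+1)^`().[z] =
  k.+1%:R / b * (1 - z / b) ^+ k.
Proof.
have /(congr1 (fun p : {poly R} => p^`().[z])) := XqE k.+1.
rewrite derivM derivX mul1r hornerD hornerM hornerX => ->.
rewrite derivB derivC sub0r hornerN deriv_exp hornerMn hornerM horner_exp gE.
rewrite /g derivB derivC sub0r derivZ derivX hornerN hornerZ hornerC mulr1.
by rewrite -mulr_natl mulNr mulrN opprK mulrA.
Qed.

(** The witness is a power of [q]. The second bound says that [p] almost satisfies the equation
    solved by the inverse power itself, which is how closeness of derivatives enters. *)
Lemma inverse_power_approx n (a e : R) : 0 < a -> a <= b -> 0 < e ->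
  exists p : {poly R}, forall z, a <= z <= b ->
    `|p.[z] - (z ^+ n.+1)^-1| <= e /\
    `|n.+1%:R * p.[z] + z * p^`().[z]| <= e.
Proof.
move=> a0 ab e0.
pose r := 1 - a / b.
have r0 : 0 <= r by rewrite subr_ge0 ler_pdivrMr// mul1r.
have r1 : r < 1 by rewrite gtrBl divr_gt0.
(* The two summands are the constants of the two estimates, so that one [k] serves both; [r] is the
   largest value of [1 - z / b] on the interval. *)
pose K := n.+1%:R * (a^-1 ^+ n.+1 + a^-1 ^+ n / b).
have K0 : 0 < K.
  by rewrite mulr_gt0// addr_gt0// ?divr_gt0// exprn_gt0// invr_gt0.
have [k hk] := succn_expr_small r0 r1 (divr_gt0 e0 K0).
have {}hk : K * (k.+1%:R * r ^+ k) <= e by rewrite mulrC -ler_pdivlMr.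
exists (q k.+1 ^+ n.+1) => z /andP[az zb].
have z0 : 0 < z := lt_le_trans a0 az.
pose u := 1 - z / b.
have u0 : 0 <= u by rewrite subr_ge0 ler_pdivrMr// mul1r.
have ur : u <= r by rewrite lerB// ler_pM2r ?invr_gt0.
have uk0 : 0 <= u ^+ k by rewrite exprn_ge0.
have ukr : u ^+ k <= r ^+ k by rewrite lerXn2r ?nnegrE.
have u1 : u <= 1 by rewrite (le_trans ur)// ltW.
have rho0 : 0 <= u ^+ k.+1 by rewrite exprn_ge0.
have rho1 : u ^+ k.+1 <= 1 by rewrite exprn_ile1.
have rhor : u ^+ k.+1 <= k.+1%:R * r ^+ k.
  rewrite exprS; apply: ler_pM => //; rewrite (le_trans u1)//.
  by rewrite ler1n.
have qz : (q k.+1).[z] = (1 - u ^+ k.+1) / z.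
  by rewrite -qE mulrAC mulfV ?mul1r// gt_eqF.
have za : z^-1 <= a^-1 by rewrite lef_pV2.
have zi0 : 0 <= z^-1 by rewrite invr_ge0 ltW.
have q0 : 0 <= (q k.+1).[z] by rewrite qz mulr_ge0// subr_ge0.
have qa : (q k.+1).[z] <= a^-1.
  by rewrite qz (le_trans _ za)// ler_piMl// gerBl.
have kr0 : 0 <= k.+1%:R * r ^+ k by rewrite mulr_ge0// exprn_ge0.
have A0 : 0 <= a^-1 by rewrite invr_ge0 ltW.
have {hk} [hk1 hk2] : k.+1%:R * r ^+ k * n.+1%:R * a^-1 ^+ n.+1 <= e /\
    n.+1%:R * (a^-1 ^+ n * (b^-1 * (k.+1%:R * r ^+ k))) <= e.
  split; apply: le_trans hk; rewrite -subr_ge0.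
    rewrite [leRHS](_ : _ =
      n.+1%:R * (a^-1 ^+ n * (b^-1 * (k.+1%:R * r ^+ k)))); last by rewrite /K; ring.
    by rewrite !mulr_ge0 ?exprn_ge0// invr_ge0 ltW.
  rewrite [leRHS](_ : _ =
    k.+1%:R * r ^+ k * n.+1%:R * a^-1 ^+ n.+1); last by rewrite /K; ring.
  by rewrite !mulr_ge0 ?exprn_ge0// invr_ge0 ltW.
split.
  rewrite horner_exp qz expr_div_n -[X in _ - X]mul1r -mulrBl normrM.
  rewrite [X in _ * X]ger0_norm ?invr_ge0 ?exprn_ge0 ?(ltW z0)// distrC.
  rewrite ger0_norm ?subr_ge0; last first.
    by rewrite exprn_ile1 ?subr_ge0// gerBl.
  apply: le_trans hk1; apply: ler_pM => //.
  - by rewrite subr_ge0 exprn_ile1 ?subr_ge0// gerBl.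
  - by rewrite invr_ge0 exprn_ge0// ltW.
  - rewrite (le_trans (subr1_expr_le _ _)) ?rho0//.
    by rewrite mulrC ler_wpM2r.
  - by rewrite -exprVn lerXn2r ?nnegrE// invr_ge0 ltW.
rewrite deriv_exp -[n.+1.-1]/n hornerMn hornerM !horner_exp exprSr.
have -> : n.+1%:R * ((q k.+1).[z] ^+ n * (q k.+1).[z]) +
    z * (((q k.+1)^`().[z] * (q k.+1).[z] ^+ n) *+ n.+1) =
    n.+1%:R * ((q k.+1).[z] ^+ n * (k.+1%:R / b * u ^+ k)).
  by rewrite -dqE -mulr_natl; ring.
have qn0 : 0 <= (q k.+1).[z] ^+ n by rewrite exprn_ge0.
rewrite ger0_norm; last first.
  by rewrite mulr_ge0// mulr_ge0// mulr_ge0// divr_ge0// ltW.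
apply: le_trans hk2; rewrite ler_wpM2l//; apply: ler_pM => //.
- by rewrite mulr_ge0// divr_ge0// ltW.
- by rewrite lerXn2r ?nnegrE.
- rewrite -mulrA mulrCA ler_wpM2l ?invr_ge0 ?(ltW b0)//.
  by rewrite ler_wpM2l.
Qed.

End polynomial_approximation.

(** * Real estimates: a Taylor remainder and the summation of increments *)

Section real_estimates.
Context (R : realType).

(** The inequality [1 - y <= exp (- y)] gives [exp y - 1 <= y exp y], so the remainder, which is
    nonnegative, is at most [y (exp y - 1)]. *)
Lemma expR_quadratic (y : R) : `|expR y - 1 - y| <= y ^+ 2 * expR `|y|.
Proof.
have h1 := expR_ge1Dx y.
rewrite ger0_norm; last by lra.
have h2 := expR_ge1Dx (- y).
have h3 : expR y - 1 <= y * expR y.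
  have := ler_wpM2r (expR_ge0 y) h2; rewrite -expRD addNr expR0; lra.
have e1 : 1 <= expR `|y| by rewrite -[leLHS]expR0 ler_expR.
have [y0|y0] := leP 0 y; first by rewrite ger0_norm// expr2; nra.
have : expR y - 1 - y <= y ^+ 2 by rewrite expr2; nra.
move=> /le_trans; apply; rewrite ler_peMr// sqr_ge0//.
Qed.

Lemma ler_dist3 (x y a b A B C : R) :
  `|x - a| <= A -> `|b - y| <= B -> `|b - a| <= C -> `|x - y| <= A + B + C.
Proof.
move=> xa yb ba; have -> : x - y = (x - a) + (b - y) - (b - a) by ring.
by rewrite (le_trans (ler_normB _ _))// lerD// (le_trans (ler_normD _ _))// lerD.
Qed.

(** Over [M + 1] equal steps the linear terms add up to [A] and the quadratic ones to [C / (M + 1)],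
    which vanishes as [M] grows. This takes the place of the mean value theorem. *)
Lemma increment_le (u : R -> R) (A C : R) :
  (forall t e, 0 <= t -> 0 <= e -> t + e <= 1 ->
    `|u (t + e) - u t| <= A * e + C * e ^+ 2) -> `|u 1 - u 0| <= A.
Proof.
move=> uAC.
have uM M : `|u 1 - u 0| <= A + C / M.+1%:R.
  have M0 : 0 < M.+1%:R :> R by rewrite ltr0n.
  pose v j := u (j%:R / M.+1%:R).
  have -> : u 1 - u 0 = \sum_(0 <= j < M.+1) (v j.+1 - v j).
    by rewrite telescope_sumr// /v mulfV ?gt_eqF// mul0r.
  rewrite big_mkord (le_trans (ler_norm_sum _ _ _))//.
  have -> : A + C / M.+1%:R =
      \sum_(j < M.+1) (A * M.+1%:R^-1 + C * M.+1%:R^-1 ^+ 2).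
    by rewrite sumr_const card_ord -[RHS]mulr_natl; field; rewrite gt_eqF.
  apply: ler_sum => j _; rewrite /v -natr1 mulrDl mul1r.
  apply: uAC; rewrite ?divr_ge0 ?invr_ge0 ?ler0n//.
  by rewrite -[X in _ + X]mul1r -mulrDl ler_pdivrMr// mul1r natr1 ler_nat.
rewrite leNgt; apply/negP => Au.
have u0 : 0 < `|u 1 - u 0| - A by rewrite subr_gt0.
pose M := Num.trunc (`|C| / (`|u 1 - u 0| - A)).
suff : A + C / M.+1%:R < `|u 1 - u 0| by rewrite ltNge uM.
rewrite -ltrBrDl ltr_pdivrMr ?ltr0n//.
rewrite (le_lt_trans (ler_norm _))// mulrC -ltr_pdivrMr//.
by have /andP[] := truncn_itv (divr_ge0 (normr_ge0 C) (ltW u0)).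
Qed.

End real_estimates.

Lemma Rintegral_itv d (T : measurableType d) (R : realType)
    (mu : probability T R) (h : T -> R) (a b : R) : bmf h ->
  (forall x, a <= h x <= b) -> a <= \int[mu]_x h x <= b.
Proof.
move=> bh hab.
have cE c : c = \int[mu]_x c by rewrite Rintegral_cst// fine_prob1 mulr1.
rewrite [X in X <= _]cE [X in _ && (_ <= X)]cE; apply/andP; split;
  apply: le_Rintegral => //; try exact/bmf_integrable/bmf_cst;
  try exact/bmf_integrable; by move=> x _; have /andP[] := hab x.
Qed.

(** * Evolution of the weighted averages in [t], and the stability identity *)

Section stability.
Context (R : realType) (H : completeNormedModType R) (dot : {dot H for idfun}).
Hypotheses (Hdot : induces_norm dot) (Hsep : separable H).
Context (d : measure_display) (Omega : measurableType d).
Context (P : probability Omega R) (G : random_probability Omega H).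
Hypothesis GG : ghirlanda_guerra dot P G.
Context (n : nat) (f : 'I_n -> R -> R).
Hypothesis n1 : (1 <= n)%N.
Hypothesis bf : forall l, bmf (f l).
Context (Phi : n.-tuple (n.-tuple R) -> R).
Hypothesis bPhi : bmf Phi.
Hypothesis Phicst : n = 1%N -> exists c, forall r, Phi r = c.

Let E N (h : Omega -> N.-tuple (borel H) -> R) := Eavg P G h.
Let D N (s : seq H) := energy dot P G f N s.

(** The quantity [Z_t]. Since [s] is a sequence of which only the first [n] entries matter,
    appending replicas to at least [n] of them leaves it unchanged. *)
Definition partition_fun (t : R) (w : Omega) (s : seq H) : R :=
  \int[gibbs G w]_x expR (t * F dot f x s).

Definition mean_energy (w : Omega) (s : seq H) : R :=
  \int[gibbs G w]_x F dot f x s.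

Definition gibbs_weight N (t : R) (s : seq H) : R :=
  Phi (overlaps dot n s) * expR (t * energy dot P G f N s).

Let Z := partition_fun.
Let V := mean_energy.
Let W := gibbs_weight.

Lemma bmf_F N :
  bmf (fun p : (Omega * N.-tuple (borel H)) * borel H => F dot f p.2 p.1.2).
Proof.
apply: bmf_sum => l _; apply: bmf_comp (bf l).
apply: (measurableT_comp (measurable_dot Hsep Hdot)
  (_ : measurable_fun setT (fun p : (Omega * N.-tuple (borel H)) * borel H =>
    (p.2, (p.1.2 : seq H)`_l : borel H)))).
apply/measurable_fun_pairP; split; first exact: measurable_snd.
apply: (measurableT_comp (@measurable_nth _ H N l)).
exact: (measurableT_comp measurable_snd measurable_fst).
Qed.

Lemma bmf_F1 (s : seq H) : bmf (fun x : borel H => F dot f x s).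
Proof.
apply: bmf_sum => l _; apply: bmf_comp (bf l).
apply: (measurableT_comp (measurable_dot Hsep Hdot)
  (_ : measurable_fun setT (fun x : borel H => (x, s`_l : borel H)))).
by apply/measurable_fun_pairP; split; [exact: measurable_id|exact: measurable_cst].
Qed.

Lemma bmf2_partition_fun N t :
  bmf2 (fun w (s : N.-tuple (borel H)) => Z t w s).
Proof.
apply: (bmf2_Rintegral_gibbs G (h := fun p => expR (t * F dot f p.2 p.1.2))).
by apply/bmf_expR/bmfM; [exact: bmf_cst|exact: bmf_F].
Qed.

Lemma bmf2_mean_energy N : bmf2 (fun w (s : N.-tuple (borel H)) => V w s).
Proof. exact: (bmf2_Rintegral_gibbs G (bmf_F N)). Qed.

Lemma bmf_energy N : bmf (fun s : N.-tuple (borel H) => D N s).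
Proof.
have bfo l i j : bmf (fun s : N.-tuple (borel H) => f l (overlap dot s i j)).
  exact: bmf_overlap.
apply: bmfD; last exact: bmf_cst.
apply: bmfB; apply: bmf_sum => j _; last exact: bfo.
by apply: bmf_sum => l _; exact: bfo.
Qed.

Lemma bmf_weight N t : bmf (fun s : N.-tuple (borel H) => W N t s).
Proof.
apply: bmfM; first exact: bmf_overlaps.
by apply/bmf_expR/bmfM; [exact: bmf_cst|exact: bmf_energy].
Qed.

Lemma F_rcons x y (s : seq H) : (n <= size s)%N ->
  F dot f x (rcons s y) = F dot f x s.
Proof.
move=> ns; apply: eq_bigr => l _.
by rewrite nth_rcons (leq_trans (ltn_ord l) ns).
Qed.

Lemma overlap_rcons y (s : seq H) i j : (i < size s)%N -> (j < size s)%N ->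
  overlap dot (rcons s y) i j = overlap dot s i j.
Proof. by move=> si sj; rewrite /overlap !nth_rcons si sj. Qed.

Lemma overlaps_rcons y (s : seq H) : (n <= size s)%N ->
  overlaps dot n (rcons s y) = overlaps dot n s.
Proof.
move=> ns; apply: eq_from_tnth => i; apply: eq_from_tnth => j.
by rewrite !tnth_mktuple overlap_rcons// (leq_trans (ltn_ord _)).
Qed.

Lemma energy_rcons N y (s : seq H) : (n <= size s)%N -> (N <= size s)%N ->
  D N (rcons s y) = D N s.
Proof.
move=> ns Ns; rewrite /D /energy; congr (_ - _ + _).
  apply: eq_bigr => j _; rewrite F_rcons// nth_rcons.
  by rewrite (leq_trans (ltn_ord j) Ns).
by apply: eq_bigr => l _; rewrite overlap_rcons// (leq_trans (ltn_ord _)).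
Qed.

Lemma energyS y (s : seq H) : (n <= size s)%N ->
  D (size s).+1 (rcons s y) = D (size s) s + F dot f y s.
Proof.
move=> ns; rewrite -(energy_rcons y ns (leqnn _)) /D /energy big_ord_recr /=.
by rewrite nth_rcons ltnn eqxx F_rcons//; ring.
Qed.

Lemma partition_fun_rcons t w y (s : seq H) : (n <= size s)%N ->
  Z t w (rcons s y) = Z t w s.
Proof. by move=> ns; apply: eq_Rintegral => x _; rewrite F_rcons. Qed.

Lemma mean_energy_rcons w y (s : seq H) : (n <= size s)%N ->
  V w (rcons s y) = V w s.
Proof. by move=> ns; apply: eq_Rintegral => x _; rewrite F_rcons. Qed.

Lemma weightS t y (s : seq H) : (n <= size s)%N ->
  W (size s).+1 t (rcons s y) = W (size s) t s * expR (t * F dot f y s).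
Proof.
move=> ns; rewrite /W /gibbs_weight overlaps_rcons// -mulrA.
rewrite -expRD -mulrDr; congr (_ * expR (_ * _)); exact: energyS.
Qed.

Lemma bmf2_WZV N t j i : bmf2 (fun w (s : N.-tuple (borel H)) =>
  W N t s * Z t w s ^+ j * V w s ^+ i).
Proof.
apply: bmfM; first apply: bmfM.
- exact: (bmf2_fst Omega (bmf_weight N t)).
- exact: (bmfX _ (bmf2_partition_fun N t)).
- exact: (bmfX _ (bmf2_mean_energy N)).
Qed.

(** Integrating out the last additional replica turns its factor [exp (t F)] into one more factor
    [Z], as nothing else depends on that replica. The exponent [j] is general because the induction
    raises it. *)
Lemma Eavg_weight k t j i :
  E (fun w (s : (k + n).-tuple (borel H)) =>
    W (k + n) t s * Z t w s ^+ j * V w s ^+ i) =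
  E (fun w (s : n.-tuple (borel H)) =>
    W n t s * Z t w s ^+ (k + j) * V w s ^+ i).
Proof.
elim: k j => [//|k ih] j.
have -> : (k.+1 + j = k + j.+1)%N by rewrite addSnnS.
rewrite -ih /E [LHS]Eavg_rcons; last exact: bmf2_WZV.
congr (Eavg P G _); apply/funext => w; apply/funext => s.
have ks : size s = (k + n)%N by rewrite size_tuple.
have ns : (n <= size s)%N by rewrite ks leq_addl.
transitivity (\int[gibbs G w]_x
    (W (k + n) t s * Z t w s ^+ j * V w s ^+ i * expR (t * F dot f x s))).
  apply: eq_Rintegral => x _ /=.
  rewrite partition_fun_rcons// mean_energy_rcons//.
  have := weightS t x ns; rewrite ks => ->.
  by ring.
rewrite RintegralZl//.
  by rewrite -/(partition_fun t w s) -/Z exprS; ring.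
apply/bmf_integrable/bmf_expR/bmfM; first exact: bmf_cst.
exact: bmf_F1.
Qed.

(** The Ghirlanda-Guerra identities concern functions of the overlap array, so the weight has to be
    presented as one. *)
Lemma weight_overlaps N t (nN : (n <= N)%N) :
  exists h : N.-tuple (N.-tuple R) -> R,
  [/\ bmf h, N = 1%N -> exists c, forall r, h r = c &
      forall s : N.-tuple (borel H), h (overlaps dot N s) = W N t s].
Proof.
pose wd := widen_ord nN.
pose a (r : N.-tuple (N.-tuple R)) i j := tnth (tnth r i) j.
pose sub (r : N.-tuple (N.-tuple R)) : n.-tuple (n.-tuple R) :=
  [tuple [tuple a r (wd i) (wd j) | j < n] | i < n].
pose c0 := \sum_(l < n)
  Eavg P G (fun _ (s' : 2.-tuple H) => f l (overlap dot s' 0 1)).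
pose h r := Phi (sub r) * expR (t * (\sum_(j < N) \sum_(l < n) f l (a r j (wd l))
  - \sum_(l < n) f l (a r (wd l) (wd l)) + c0)).
have ma i j : measurable_fun setT (fun r => a r i j).
  rewrite (_ : (fun _ => _) = (@tnth N R ^~ j) \o (@tnth N (N.-tuple R) ^~ i))//.
  by apply: measurableT_comp; exact: measurable_tnth.
exists h; split.
- apply: bmfM.
    apply: bmf_comp bPhi.
    apply/measurable_fun_tnthP => i; apply/measurable_fun_tnthP => j.
    rewrite (_ : _ \o _ = fun r => a r (wd i) (wd j)); first exact: ma.
    by apply/funext => r /=; rewrite !tnth_mktuple.
  apply/bmf_expR/bmfM; first exact: bmf_cst.
  apply: bmfD; last exact: bmf_cst.
  apply: bmfB; apply: bmf_sum => j _; last exact: bmf_comp (ma _ _) (bf _).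
  by apply: bmf_sum => l _; exact: bmf_comp (ma _ _) (bf _).
(* With a single replica [Phi] is constant and the double sum is the self-overlap term alone, which
   is subtracted; nothing depending on the array remains. *)
- move=> N1; have ne1 : n = 1%N.
    by apply/eqP; rewrite eqn_leq n1 -[X in (_ <= X)%N]N1 nN.
  have [c hc] := Phicst ne1; exists (c * expR (t * c0)) => r.
  rewrite /h hc exchange_big /= -sumrB big1 ?add0r// => l _.
  rewrite (bigD1 (wd l))//= big_pred0 ?addr0 ?subrr// => j.
  apply/negbTE; rewrite negbK -val_eqE /=.
  have := ltn_ord j; have := ltn_ord l; rewrite [X in (_ < X)%N -> _]ne1.
  by rewrite [X in _ -> (_ < X)%N -> _]N1 !ltnS !leqn0 => /eqP -> /eqP ->.
- move=> s; rewrite /h /W /gibbs_weight /energy; congr (Phi _ * expR (_ * _)).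
    apply: eq_from_tnth => i; apply: eq_from_tnth => j.
    by rewrite /sub /a !tnth_mktuple.
  congr (_ - _ + _).
    apply: eq_bigr => j _; apply: eq_bigr => l _.
    by rewrite /a !tnth_mktuple.
  by apply: eq_bigr => l _; rewrite /a !tnth_mktuple.
Qed.

(** The left side is the formal [t]-derivative of the average of [W]. By the summed identity it is a
    mean of [F] at a new replica, which integrates to [V]; the [k] additional replicas then
    integrate to [Z ^ k]. *)
Lemma Eavg_weight_energy k t :
  E (fun _ (s : (k + n).-tuple (borel H)) => W (k + n) t s * D (k + n) s) =
  (k + n)%:R * E (fun w (s : n.-tuple (borel H)) =>
    W n t s * Z t w s ^+ k * V w s ^+ 1).
Proof.
have nN : (n <= k + n)%N by exact: leq_addl.
have [h [bh h1 hW]] := weight_overlaps t nN.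
have := ghirlanda_guerra_energy Hdot Hsep GG bf nN bh h1.
have -> : Eavg P G (fun _ (s : (k + n).-tuple (borel H)) =>
    h (overlaps dot (k + n) s) * energy dot P G f (k + n) s) =
    E (fun _ (s : (k + n).-tuple (borel H)) => W (k + n) t s * D (k + n) s).
  congr (Eavg P G _); apply/funext => w; apply/funext => s.
  by rewrite hW.
move=> ->; congr (_ * _).
have := Eavg_weight k t 0 1; rewrite addn0 => <-.
rewrite /E Eavg_rcons; last first.
  apply: bmfM; first exact: (bmf2_fst Omega (bmf_overlaps Hdot Hsep _ bh)).
  have bF : bmf (fun s : (k + n).+1.-tuple (borel H) =>
      F dot f (s : seq H)`_(k + n) s).
    by apply: bmf_sum => l _; exact: bmf_overlap.
  exact: (bmf2_fst Omega bF).
congr (Eavg P G _); apply/funext => w; apply/funext => s.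
have ks : size s = (k + n)%N by rewrite size_tuple.
transitivity (\int[gibbs G w]_x (W (k + n) t s * F dot f x s)).
  apply: eq_Rintegral => x _ /=.
  rewrite F_rcons ?ks// nth_rcons ks ltnn eqxx; congr (_ * _).
  rewrite -hW; congr h.
  apply: eq_from_tnth => i; apply: eq_from_tnth => j.
  by rewrite !tnth_mktuple overlap_rcons// ks.
rewrite RintegralZl//; first by rewrite expr0 mulr1 expr1.
exact/bmf_integrable/bmf_F1.
Qed.

Let S i (p : {poly R}) t := E (fun w (s : n.-tuple (borel H)) =>
  W n t s * p.[Z t w s] * V w s ^+ i).

Lemma bmf2_horner N t (p : {poly R}) :
  bmf2 (fun w (s : N.-tuple (borel H)) => p.[Z t w s]).
Proof.
rewrite /bmf2 (eq_fun (fun x : Omega * N.-tuple (borel H) =>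
  horner_coef p (Z t x.1 x.2))).
apply: bmf_sum => j _; apply: bmfM; first exact: bmf_cst.
exact: (bmfX _ (bmf2_partition_fun N t)).
Qed.

Lemma Eavg_horner i m (p : {poly R}) t : (size p <= m)%N ->
  S i p t = \sum_(j < m) p`_j * E (fun w (s : n.-tuple (borel H)) =>
    W n t s * Z t w s ^+ j * V w s ^+ i).
Proof.
move=> pm; transitivity (E (fun w (s : n.-tuple (borel H)) => \sum_(j < m)
    p`_j * (W n t s * Z t w s ^+ j * V w s ^+ i))).
  congr (Eavg P G _); apply/funext => w; apply/funext => s.
  rewrite (horner_coef_wide _ pm) mulr_sumr mulr_suml.
  by apply: eq_bigr => j _; ring.
rewrite /E Eavg_sum => [|j _]; last first.
  by apply: bmfM; [exact: bmf_cst|exact: bmf2_WZV].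
by apply: eq_bigr => j _; rewrite EavgZ//; exact: bmf2_WZV.
Qed.

(** Over [k + n] replicas the powers of [Z] disappear into a single exponential of the energy, whose
    increment is controlled pointwise by [expR_quadratic]. *)
Lemma weight_increment k : exists C, forall t e,
    0 <= t -> t <= 1 -> 0 <= e -> e <= 1 ->
  `|E (fun w (s : n.-tuple (borel H)) =>
        W n (t + e) s * Z (t + e) w s ^+ k * V w s ^+ 0)
    - E (fun w (s : n.-tuple (borel H)) =>
        W n t s * Z t w s ^+ k * V w s ^+ 0)
    - e * ((k + n)%:R * E (fun w (s : n.-tuple (borel H)) =>
        W n t s * Z t w s ^+ k * V w s ^+ 1))| <= C * e ^+ 2.
Proof.
have [_ [B hB]] := bPhi; have [_ [M hM]] := bmf_energy (k + n).
(* [B] bounds [Phi], [expR M] bounds the weight at [t], and the last factor bounds the Taylor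
   remainder up to [e ^+ 2]. *)
exists (B * expR M * (M ^+ 2 * expR M)) => t e t0 t1 e0 e1.
have bW u : bmf2 (fun (_ : Omega) (s : (k + n).-tuple (borel H)) =>
    W (k + n) u s).
  exact: (bmf2_fst Omega (bmf_weight _ _)).
have bD : bmf2 (fun (_ : Omega) (s : (k + n).-tuple (borel H)) => D (k + n) s).
  exact: (bmf2_fst Omega (bmf_energy _)).
have bWD u : bmf2 (fun (_ : Omega) (s : (k + n).-tuple (borel H)) =>
    W (k + n) u s * D (k + n) s) by exact: (bmfM (bW u) bD).
have beWD u : bmf2 (fun (_ : Omega) (s : (k + n).-tuple (borel H)) =>
    e * (W (k + n) u s * D (k + n) s)) by exact: (bmfM (bmf_cst e) (bWD u)).
have bWB u v : bmf2 (fun (_ : Omega) (s : (k + n).-tuple (borel H)) =>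
    W (k + n) u s - W (k + n) v s) by exact: (bmfB (bW u) (bW v)).
have WE u : E (fun w (s : n.-tuple (borel H)) =>
      W n u s * Z u w s ^+ k * V w s ^+ 0) =
    E (fun _ (s : (k + n).-tuple (borel H)) => W (k + n) u s).
  have := Eavg_weight k u 0 0; rewrite addn0 => <-; congr (Eavg P G _).
  by apply/funext => w; apply/funext => s; rewrite !expr0 !mulr1.
rewrite !WE -Eavg_weight_energy /E -EavgZ// -EavgB// -EavgB//.
apply: ler_norm_Eavg; first exact: (bmfB (bWB _ _) (beWD _)).
move=> w s; rewrite /W /gibbs_weight -/(D _ _).
set x := D _ _; have xM : `|x| <= M := hM s.
have M0 : 0 <= M := le_trans (normr_ge0 _) xM.
rewrite [X in `|X|](_ : _ =
    Phi (overlaps dot n s) * (expR (t * x) * (expR (e * x) - 1 - e * x))); last first.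
  by rewrite mulrDl expRD; ring.
rewrite normrM -!mulrA; apply: ler_pM => //.
rewrite normrM; apply: ler_pM => //.
  rewrite ger0_norm ?expR_ge0// ler_expR (le_trans (ler_norm _))// normrM.
  by rewrite (ger0_norm t0) -[leRHS]mul1r ler_pM.
rewrite (le_trans (expR_quadratic _))//.
have exM : `|e * x| <= M by rewrite normrM (ger0_norm e0) -[leRHS]mul1r ler_pM.
rewrite exprMn [leRHS](_ : _ = e ^+ 2 * M ^+ 2 * expR M); last by ring.
apply: ler_pM => //; [| |by rewrite ler_expR].
  by rewrite mulr_ge0// exprn_even_ge0.
by rewrite ler_wpM2l ?exprn_even_ge0// -real_normK ?num_real// lerXn2r ?nnegrE.
Qed.

(* [n p + X p'] vanishes for [p = X^-n], which is where the power of the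
   partition function in the theorem comes from. *)
Lemma horner_increment (p : {poly R}) : exists C, forall t e,
    0 <= t -> 0 <= e -> t + e <= 1 ->
  `|S 0 p (t + e) - S 0 p t - e * S 1 (n%:R *: p + 'X * p^`()) t| <= C * e ^+ 2.
Proof.
have [C hC] := choice weight_increment.
pose p' := n%:R *: p + 'X * p^`().
pose m := maxn (size p) (size p').
(* These are the factors [k + n] that [weight_increment] produces for the monomials. *)
have p'E j : p'`_j = (j + n)%:R * p`_j.
  rewrite /p' coefD coefZ coefXM coef_deriv; case: j => [|j] /=.
    by rewrite addr0.
  by rewrite -[_ *+ j.+1]mulr_natl (natrD _ j.+1); ring.
exists (\sum_(j < m) `|p`_j| * C j) => t e t0 e0 te1.
have t1 : t <= 1 by lra.
have e1 : e <= 1 by lra.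
rewrite !(@Eavg_horner _ m) ?leq_maxl ?leq_maxr// mulr_sumr -!sumrB mulr_suml.
rewrite (le_trans (ler_norm_sum _ _ _))//; apply: ler_sum => j _.
have distr (x a b c u v : R) : u * a - u * b - x * (v * u * c) =
  u * (a - b - x * (v * c)) by ring.
rewrite -mulrA -/p' p'E distr normrM ler_wpM2l//.
exact: hC.
Qed.

Lemma F_bounded : exists L, forall x s, `|F dot f x s| <= L.
Proof.
have [M hM] := choice (fun l => (bf l).2).
exists (\sum_(l < n) M l) => x s.
by rewrite (le_trans (ler_norm_sum _ _ _))//; exact: ler_sum.
Qed.

Lemma Eavg_stability :
  E (fun _ (s : n.-tuple (borel H)) => Phi (overlaps dot n s)) =
  E (fun w (s : n.-tuple (borel H)) => W n 1 s / Z 1 w s ^+ n).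
Proof.
have [L hL] := F_bounded.
have L0 : 0 <= L := le_trans (normr_ge0 _) (hL 0 [::]).
have [_ [B hB]] := bPhi; have [_ [M hM]] := bmf_energy n.
pose s0 : n.-tuple (borel H) := [tuple 0 | i < n].
have B0 : 0 <= B := le_trans (normr_ge0 _) (hB (overlaps dot n s0)).
have Zb t w s : 0 <= t <= 1 -> expR (- L) <= Z t w s <= expR L.
  move=> /andP[t0 t1]; apply: Rintegral_itv => [|x].
    by apply/bmf_expR/bmfM; [exact: bmf_cst|exact: bmf_F1].
  rewrite !ler_expR -ler_norml normrM (ger0_norm t0) -[leRHS]mul1r.
  by rewrite ler_pM.
have Z0 w s : Z 0 w s = 1.
  rewrite /Z /partition_fun; under eq_Rintegral do rewrite mul0r expR0.
  by rewrite Rintegral_cst// fine_prob1 mulr1.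
have Vb w s : `|V w s| <= L by apply: ler_normr_Rintegral => //; exact: bmf_F1.
pose K := B * expR M.
have Wb t (s : n.-tuple (borel H)) : 0 <= t <= 1 -> `|W n t s| <= K.
  move=> /andP[t0 t1]; rewrite normrM ler_pM// ger0_norm ?expR_ge0//.
  rewrite ler_expR (le_trans (ler_norm _))// normrM (ger0_norm t0).
  by rewrite -[leRHS]mul1r ler_pM// hM.
have K0 : 0 <= K by rewrite mulr_ge0// expR_ge0.
have bW t : bmf2 (fun (_ : Omega) (s : n.-tuple (borel H)) => W n t s).
  exact: (bmf2_fst Omega (bmf_weight _ _)).
have bPh : bmf2 (fun (_ : Omega) (s : n.-tuple (borel H)) =>
    Phi (overlaps dot n s)).
  exact: (bmf2_fst Omega (bmf_overlaps Hdot Hsep _ bPhi)).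
have t01 : 0 <= (1 : R) <= 1 by rewrite ler01 lexx.
have Zp w s : 0 < Z 1 w s.
  by have /andP[+ _] := Zb 1 w s t01; apply: lt_le_trans; exact: expR_gt0.
have blnZ : bmf2 (fun w (s : n.-tuple (borel H)) => ln (Z 1 w s)).
  split.
    exact: (measurableT_comp (@measurable_ln R) (bmf2_partition_fun n 1).1).
  exists L => -[w s] /=; rewrite ler_norml -(expRK (- L)) -[in X in _ && X](expRK L).
  by rewrite !ler_ln ?posrE ?expR_gt0//; exact: Zb.
(* The reciprocal is written as [exp (- n ln Z)], to which the closure properties apply. *)
have bV : bmf2 (fun w (s : n.-tuple (borel H)) => (Z 1 w s ^+ n)^-1).
  have := bmf_expR (bmfN (bmfM (bmf_cst n%:R) blnZ)).
  congr bmf; apply/funext => -[w s] /=.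
  by rewrite expRN expRM_natl lnK// posrE.
have bWV : bmf2 (fun w (s : n.-tuple (borel H)) => W n 1 s / Z 1 w s ^+ n).
  exact: (bmfM (bW 1) bV).
have bS i p t : bmf2 (fun w (s : n.-tuple (borel H)) =>
    W n t s * p.[Z t w s] * V w s ^+ i).
  exact: (bmfM (bmfM (bW t) (bmf2_horner n t p)) (bmfX i (bmf2_mean_energy n))).
(* The three errors come from replacing the inverse power by [p] at [t = 0], the same at [t = 1],
   and the drift of the average with [p] in between. *)
have main e : 0 < e ->
    `|E (fun _ (s : n.-tuple (borel H)) => Phi (overlaps dot n s)) -
      E (fun w (s : n.-tuple (borel H)) => W n 1 s / Z 1 w s ^+ n)|
    <= B * e + K * e + K * L * e.
  move=> e0.
  have LL : expR (- L) <= expR L by rewrite ler_expR; lra.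
  (* The interval contains every value of [Z t] for [t] in the unit interval; the predecessor
     compensates for the exponent [n.+1] of the lemma. *)
  have [p] := inverse_power_approx (expR_gt0 L) n.-1 (expR_gt0 (- L)) LL e0.
  rewrite prednK// => hp.
  have p1 : `|S 0 p 1 - E (fun w (s : n.-tuple (borel H)) =>
      W n 1 s / Z 1 w s ^+ n)| <= K * e.
    rewrite /S /E -EavgB//; apply: ler_norm_Eavg => [|w s].
      exact: (bmfB (bS 0 p 1) bWV).
    rewrite expr0 mulr1 -mulrBr normrM ler_pM ?Wb//.
    exact: (hp _ (Zb _ _ _ t01)).1.
  have p2 : `|S 0 p 1 - S 0 p 0| <= K * L * e.
    have [C hC] := horner_increment p.
    apply: (@increment_le _ _ _ C) => t e' t0 e'0 te1.
    have tt : 0 <= t <= 1 by apply/andP; split; lra.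
    have hT : `|S 1 (n%:R *: p + 'X * p^`()) t| <= K * L * e.
      apply: ler_norm_Eavg => [//|w s].
      rewrite hornerD hornerZ hornerM hornerX expr1 2!normrM mulrAC.
      by rewrite !ler_pM ?mulr_ge0 ?Wb//; exact: (hp _ (Zb _ _ _ tt)).2.
    have := hC t e' t0 e'0 te1.
    set x := S 0 p _ - _; set y := S 1 _ _ => xy.
    rewrite -[x](subrK (e' * y)) (le_trans (ler_normD _ _))// addrC.
    by rewrite lerD// normrM (ger0_norm e'0) mulrC ler_wpM2r.
  have p3 : `|E (fun _ (s : n.-tuple (borel H)) => Phi (overlaps dot n s)) -
      S 0 p 0| <= B * e.
    rewrite distrC /S /E -EavgB//; apply: ler_norm_Eavg => [|w s].
      exact: (bmfB (bS 0 p 0) bPh).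
    rewrite expr0 mulr1 /W /gibbs_weight mul0r expR0 mulr1 Z0.
    rewrite -[X in _ - X]mulr1 -mulrBr normrM ler_pM//.
    have z1 : expR (- L) <= 1 <= expR L.
      by rewrite -expR0 !ler_expR oppr_le0 L0.
    by have [+ _] := hp 1 z1; rewrite expr1n invr1.
  exact: ler_dist3 p3 p1 p2.
apply/eqP; rewrite -subr_eq0 -normr_eq0; apply/eqP/le_anti/andP; split => //.
rewrite leNgt; apply/negP => d0.
have C0 : 0 <= B + K + K * L by rewrite !addr_ge0// mulr_ge0.
have C1 : 0 < B + K + K * L + 1 by rewrite ltr_wpDl.
have := main _ (divr_gt0 d0 C1); rewrite -!mulrDl leNgt => /negP; apply.
by rewrite mulrCA gtr_pMr// ltr_pdivrMr// mul1r ltrDl.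
Qed.

End stability.

Theorem theorem2 (R : realType)
  (H : completeNormedModType R) (dot : {dot H for idfun})
  (Hdot : induces_norm dot) (Hsep : separable H)
  (d : measure_display) (Omega : measurableType d) (P : probability Omega R)
  (G : random_probability Omega H)
  (Gball : {ae P, forall w, gibbs G w [set x : H | `|x| <= 1] = 1%E})
  (GG : ghirlanda_guerra dot P G)
  (n : nat) (n1 : (1 <= n)%N)
  (f : 'I_n -> R -> R)
  (fmeas : forall l, measurable_fun setT (f l))
  (fbnd : forall l, bounded_fun (f l))
  (Phi : n.-tuple (n.-tuple R) -> R)
  (Phimeas : measurable_fun setT Phi) (Phibnd : bounded_fun Phi)
  (Phicst : n = 1%N -> exists c : R, forall r, Phi r = c) :
  Eavg P G (fun _ (s : n.-tuple H) => Phi (overlaps dot n s)) =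
  Eavg P G (fun w (s : n.-tuple H) =>
    Phi (overlaps dot n s)
      * expR (\sum_(l < n) Fl dot P G f l s`_l s)
      / (\int[gibbs G w]_x expR (F dot f x s)) ^+ n).
Proof.
have bf l : bmf (f l) by split=> //; exact/bounded_funP.
have bPhi : bmf Phi by split=> //; exact/bounded_funP.
have := Eavg_stability Hdot Hsep GG n1 bf bPhi Phicst.
move=> ->; congr (Eavg P G _); apply/funext => w; apply/funext => s.
rewrite /gibbs_weight /partition_fun mul1r /energy.
congr (_ * expR _ / _ ^+ n).
  (* With exactly [n] replicas every one is corrected, so the energy is the sum of the [Fl]. *)
  by rewrite /Fl big_split sumrB.
by apply: eq_Rintegral => x _; rewrite mul1r.
Qed.
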